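(* For a consecutive pattern $p$, let $\mathbf{p}(\mathcal{P}_n)$ denote the popularity of $p$ in the set $\mathcal{P}_n$ of faro permutations of length $n$, i.e. the total number of occurrences of $p$ over all permutations in $\mathcal{P}_n$. Then for $n\ge2$, $$\mathbf{21}(\mathcal{P}_n)=\frac{n+1}{2}\binom{n}{\lfloor n/2\rfloor}-2^{n-1},$$ $$\mathbf{12}(\mathcal{P}_n)=(n-1)\binom{n}{\lfloor n/2\rfloor}-\mathbf{21}(\mathcal{P}_n),$$ $$\mathbf{123}(\mathcal{P}_n)=2^n-2\binom{n-1}{\lfloor (n-1)/2\rfloor}-\binom{n}{\lfloor n/2\rfloor},$$ $$\mathbf{132}(\mathcal{P}_n)=\mathbf{213}(\mathcal{P}_n)=\frac12\left((n-2)\binom{n}{\lfloor n/2\rfloor}-\mathbf{123}(\mathcal{P}_n)\right).$$ Moreover, as $n\to\infty$, $\mathbf{21}(\mathcal{P}_n)$, $\mathbf{12}(\mathcal{P}_n)$, $\mathbf{132}(\mathcal{P}_n)$ and $\mathbf{213}(\mathcal{P}_n)$ are each asymptotically equivalent to $\sqrt{\frac{n}{2\pi}}\cdot2^n$, and $\mathbf{123}(\mathcal{P}_n)\sim2^n$.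
   Context: A faro permutation of length $n$ is a permutation $w=w_1\cdots w_n$ of $\{1,\dots,n\}$ obtained by interlacing two increasing words $u,v$ as $u_1v_1u_2v_2\cdots$ with $0\le|u|-|v|\le1$ (equivalently, $w_i<w_{i+2}$ for all $1\le i\le n-2$). An occurrence of a consecutive pattern $p=p_1\cdots p_m$ in $w$ is a factor $w_iw_{i+1}\cdots w_{i+m-1}$ order-isomorphic to $p$. *)

(* Defs.v *)
From mathcomp Require Export all_boot all_order all_algebra.
From mathcomp Require Export all_classical all_reals all_analysis.
Export numFieldNormedType.Exports.

Set Implicit Arguments.
Unset Strict Implicit.
Unset Printing Implicit Defensive.

(* u_1 v_1 u_2 v_2 ...; only meant for [0 <= size u - size v <= 1]. *)
Fixpoint interlace (u v : seq nat) : seq nat :=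
  match u, v with
  | x :: u', y :: v' => x :: y :: interlace u' v'
  | [::], _ => v
  | _, [::] => u
  end.

Definition is_faro (w : seq nat) : Prop :=
  exists u v : seq nat,
    [/\ sorted ltn u, sorted ltn v,
        (size v <= size u <= (size v).+1)%N & w = interlace u v].

(* Permutations are handled in one-line notation, as words on 1, ..., n. *)
Definition faro_perms (n : nat) : seq (seq nat) :=
  [seq w <- permutations (iota 1 n) | `[< is_faro w >]].

Definition order_isomorphic (s t : seq nat) : bool :=
  (size s == size t) &&
  [forall i : 'I_(size s), forall j : 'I_(size s),
    (nth 0%N s i < nth 0%N s j)%N == (nth 0%N t i < nth 0%N t j)%N].

Definition factor (w : seq nat) (i m : nat) : seq nat := take m (drop i w).

(* Starting positions are counted from 0. *)
Definition occurrences (p w : seq nat) : nat :=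
  count (fun i => (i + size p <= size w)%N
                  && order_isomorphic (factor w i (size p)) p)
        (iota 0 (size w).+1).

Definition popularity (p : seq nat) (n : nat) : nat :=
  (\sum_(w <- faro_perms n) occurrences p w)%N.

(* Main.v *)
Require Import Defs.
From mathcomp Require Import all_boot all_order all_algebra.
From mathcomp Require Import all_classical all_reals all_analysis.
From mathcomp Require Import zify ring lra.
Import Order.TTheory GRing.Theory Num.Theory.
Import numFieldNormedType.Exports.

(** A faro permutation [w = u_1 v_1 u_2 v_2 ...] of length [n] is determined by
the set of values in [u], that is, by a path of [n] steps, the [y]-th step
going up when [y] lies in [u] and down otherwise.  Such a path has [uphalf n]
up steps, so there are [C(n, h)] faro permutations, where [h = n./2]
([faro_perms_words]).

Descents.  Around [v_i] one has [u_i < u_(i+1)], so exactly one of the pairs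
[u_i v_i] and [v_i u_(i+1)] is a descent, unless [u_i < v_i < u_(i+1)], when
neither is (at the right end, read [u_(i+1)] as infinity).  In the
exceptional case exactly [i] up steps precede the [i]-th down step, which
therefore returns from height 1 to height 0.  The number of descents
is thus [h] minus the number of these returns ([descents_returns]).  The
total number of returns over all paths is a sum of products of binomial
coefficients, which the identity
[sum_k C(2k,k) C(2m-2k,m-k) = 4^m] ([central_convolution]) evaluates;
this yields [2 * p(21) + 2^n = (n+1) C(n, h)] ([popularity_21]), [p] denoting
popularity.  Two neighbours form either 12 or 21, whence [p(12)].

Patterns of length 3.  Since [w_i < w_(i+2)], a factor of length 3 is a 213
when its first pair is a descent, a 132 when its second pair is, and a 123
otherwise.  So [p(213)] counts all descents but those in the last position,
and [p(132)] all but those in the first position.  A descent in the first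
position means that the path starts with a down step; one in the last position
fixes the last step.  Both conditions hold for [C(n-1, uphalf n)] paths.  This gives
[p(132) = p(213)], and [p(123)] is what remains of the [n-2] factors.

Asymptotics.  [C(n, h) / 2^n = C(2q, q) / 4^q] with [q = uphalf n], and the
Wallis numbers, the integrals of [sin^n] over [0, pi/2], decrease in [n]; their
values for [2q-1], [2q] and [2q+1] enclose [C(2q, q) / 4^q] so tightly that
[2 / (pi (n+2)) <= (C(n, h) / 2^n)^2 <= 2 / (pi n)] ([half_mass_bounds]).
Everything else is a limit of elementary expressions. *)

Set Implicit Arguments.
Unset Strict Implicit.
Unset Printing Implicit Defensive.

(** * Up-down words and their number *)

Fixpoint bits (n : nat) : seq bitseq :=
  if n is m.+1 then map (cons true) (bits m) ++ map (cons false) (bits m)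
  else [:: [::]].

Lemma mem_bits n b : (b \in bits n) = (size b == n).
Proof.
elim: n b => [|n IH] [|x b] //=; rewrite mem_cat.
  by apply/negbTE; rewrite negb_or; apply/andP; split; apply/mapP => -[].
rewrite eqSS -IH; apply/orP/idP => [[] /mapP[c cn [_ ->]] //|bn].
by case: x; [left|right]; apply: map_f.
Qed.

Lemma bits_uniq n : uniq (bits n).
Proof.
elim: n => //= n IH; have cons_inj x : injective (@cons bool x) by move=> ? ? [].
rewrite cat_uniq !map_inj_uniq // IH andbT /=; apply/hasPn => ? /mapP[b _ ->].
by apply/mapP => -[].
Qed.

Lemma big_bits_cat k l (F : bitseq -> nat) :
  \sum_(w <- bits (k + l)) F w =
  \sum_(x <- bits k) \sum_(y <- bits l) F (x ++ y).
Proof.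
elim: k F => [|k IH] F; first by rewrite big_seq1.
by rewrite addSn /= !big_cat !big_map /= !IH.
Qed.

Lemma sum_bits_count n a : \sum_(w <- bits n) (count id w == a) = 'C(n, a).
Proof.
elim: n a => [|n IH] a; first by rewrite big_seq1; case: a.
rewrite /= big_cat !big_map /=; case: a => [|a].
  by rewrite big1 // add0n IH !bin0.
rewrite binS addnC; congr (_ + _); first exact: IH.
by rewrite -IH; apply: eq_bigr => w _; rewrite add1n eqSS.
Qed.

Definition balanced_bits (n : nat) : seq bitseq :=
  [seq b <- bits n | count id b == uphalf n].

Lemma sum_balanced n (F : bitseq -> nat) :
  \sum_(b <- balanced_bits n) F b =
  \sum_(b <- bits n) (count id b == uphalf n) * F b.
Proof.
by rewrite big_filter big_mkcond; apply: eq_bigr => b _; case: ifP; rewrite ?mul1n.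
Qed.

(** * Faro permutations as lattice paths *)

(** In [b], read as a path, [true] is an up step and [false] a down step; the
value [y] is attached to the [y]-th step. *)
Definition upper (b : bitseq) : seq nat := mask b (iota 1 (size b)).
Definition lower (b : bitseq) : seq nat := mask (map negb b) (iota 1 (size b)).
Definition faro_word (b : bitseq) : seq nat := interlace (upper b) (lower b).

Lemma count_negb (b : bitseq) : count id (map negb b) = size b - count id b.
Proof.
rewrite count_map -(count_predC id b) addnC addnK; exact: eq_count.
Qed.

Lemma size_upper b : size (upper b) = count id b.
Proof. by rewrite size_mask // size_iota. Qed.

Lemma size_lower b : size (lower b) = size b - count id b.
Proof. by rewrite size_mask ?size_map ?size_iota // count_negb. Qed.

Lemma upper_sorted b : sorted ltn (upper b).
Proof. by apply: sorted_mask; [exact: ltn_trans|exact: iota_ltn_sorted]. Qed.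

Lemma lower_sorted b : sorted ltn (lower b).
Proof. by apply: sorted_mask; [exact: ltn_trans|exact: iota_ltn_sorted]. Qed.

Lemma balancedP n b : b \in balanced_bits n ->
  [/\ size b = n, count id b = uphalf n, size (upper b) = uphalf n
    & size (lower b) = n./2].
Proof.
rewrite mem_filter mem_bits => /andP[/eqP c /eqP s]; split => //.
  by rewrite size_upper.
by rewrite size_lower c s; lia.
Qed.

Lemma upper_lower_size n b : b \in balanced_bits n ->
  size (lower b) <= size (upper b) <= (size (lower b)).+1.
Proof. by case/balancedP => _ _ -> ->; lia. Qed.

Lemma nth_interlace (u v : seq nat) k : size v <= size u <= (size v).+1 ->
  nth 0 (interlace u v) k = if odd k then nth 0 v k./2 else nth 0 u k./2.
Proof.
elim: u v k => [|x u IH] [|y v] k //=; first by rewrite !nth_nil if_same.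
  by case: u {IH} => //= _; case: k => [|[|k]] //=; rewrite !nth_nil if_same.
by case: k => [|[|k]] //= H; rewrite negbK IH.
Qed.

Lemma perm_interlace (u v : seq nat) : perm_eq (interlace u v) (u ++ v).
Proof.
elim: u v => [|x u IH] [|y v] //=; first by rewrite cats0.
by rewrite perm_cons perm_sym -cat1s perm_catCA /= perm_cons perm_sym.
Qed.

Lemma interlace_inj (u v u' v' : seq nat) :
  size u = size u' -> size v = size v' ->
  interlace u v = interlace u' v' -> u = u'.
Proof.
elim: u v u' v' => [|x u IH] [|y v] [|x' u'] [|y' v'] //=.
by move=> [su] [sv] [<- _ /(IH _ _ _ su sv) ->].
Qed.

(** Membership in the mask of a duplicate-free sequence reads off the bits. *)
Lemma mask_iota_inj m n (b b' : bitseq) : size b = n -> size b' = n ->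
  mask b (iota m n) = mask b' (iota m n) -> b = b'.
Proof.
move=> sb sb' e; apply: (@eq_from_nth _ false); first by rewrite sb.
move=> i; rewrite sb => ltin.
have H (c : bitseq) : size c = n -> (m + i \in mask c (iota m n)) = nth false c i.
  move=> sc; rewrite in_mask ?iota_uniq // mem_iota leq_addr ltn_add2l ltin.
  by rewrite -(nth_iota m m ltin) index_uniq ?size_iota ?iota_uniq.
by rewrite -(H b) // -(H b') // e.
Qed.

Lemma faro_word_inj n : {in balanced_bits n &, injective faro_word}.
Proof.
move=> b c /balancedP[sb _ ub lb] /balancedP[sc _ uc lc] /interlace_inj.
rewrite ub uc lb lc => /(_ erefl erefl).
by rewrite /upper sb sc; apply: mask_iota_inj.
Qed.

Lemma perm_mask_negb (T : eqType) (b : bitseq) (s : seq T) : size b = size s ->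
  perm_eq (mask b s ++ mask (map negb b) s) s.
Proof.
elim: b s => [|x b IH] [|y s] //= [e]; case: x => /=.
  by rewrite perm_cons IH.
by rewrite (perm_catCA _ [:: y]) /= perm_cons IH.
Qed.

Lemma faro_word_perm b : perm_eq (faro_word b) (iota 1 (size b)).
Proof.
apply: perm_trans (perm_interlace _ _) _.
by apply: perm_mask_negb; rewrite size_iota.
Qed.

(** The inverse of [faro_word] sends [w = interlace u v] to the indicator of
[u] on [1, ..., n]: a sorted word is recovered from its set of letters. *)
Lemma faro_perms_words n : perm_eq (faro_perms n) (map faro_word (balanced_bits n)).
Proof.
apply: uniq_perm; first by rewrite filter_uniq // permutations_uniq.
  rewrite map_inj_in_uniq ?filter_uniq ?bits_uniq //.
  exact: faro_word_inj.
move=> w; rewrite mem_filter mem_permutations.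
apply/andP/mapP => [[/asboolP[u [v [su sv suv ->]]] pw]|[b bn ->]]; last first.
  have [sb _ _ _] := balancedP bn; split; last by rewrite -sb faro_word_perm.
  apply/asboolP; exists (upper b), (lower b).
  by rewrite upper_sorted lower_sorted (upper_lower_size bn).
have puv : perm_eq (u ++ v) (iota 1 n).
  by rewrite -(permPl (perm_interlace u v)).
have : uniq (u ++ v) by rewrite (perm_uniq puv) iota_uniq.
rewrite cat_uniq => /and3P[_ /hasPn dis _].
have mem_uv x : (x \in iota 1 n) = (x \in u) || (x \in v).
  by rewrite -(perm_mem puv) mem_cat.
have sorted_eq_mask (s : seq nat) : sorted ltn s -> {subset s <= iota 1 n} ->
    s = mask (map (mem s) (iota 1 n)) (iota 1 n).
  move=> ss sub; rewrite -filter_mask.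
  apply: (irr_sorted_eq ltn_trans ltnn) => //.
    apply: sorted_filter; first exact: ltn_trans.
    exact: iota_ltn_sorted.
  by move=> x; rewrite mem_filter; apply/idP/andP => [xs|[]//]; split => //; exact: sub.
have snn : size u + size v = n by rewrite -size_cat (perm_size puv) size_iota.
pose b := map (mem u) (iota 1 n).
have sb : size b = n by rewrite size_map size_iota.
have ub : u = upper b.
  rewrite /upper sb; apply: sorted_eq_mask => // x xu.
  by rewrite mem_uv xu.
have vb : v = lower b.
  rewrite /lower sb -map_comp {1}[v](sorted_eq_mask v) //; last first.
    by move=> x xv; rewrite mem_uv xv orbT.
  congr mask; apply/eq_in_map => x; rewrite mem_uv /=.
  by have [/dis/negbTE -> //|_] := boolP (x \in v); rewrite orbF => ->.
exists b; last by rewrite /faro_word -ub -vb.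
rewrite mem_filter mem_bits sb eqxx andbT -size_upper -ub.
by lia.
Qed.

(** * Occurrences and descents *)

(** Replaces the quantification over ordinals by one over lists, which computes
on patterns of explicit length. *)
Lemma order_isomorphicE (s t : seq nat) : order_isomorphic s t =
  (size s == size t) &&
  all (fun i => all (fun j => (nth 0 s i < nth 0 s j) == (nth 0 t i < nth 0 t j))
         (iota 0 (size s))) (iota 0 (size s)).
Proof.
congr (_ && _); apply/forallP/allP => H.
  move=> i; rewrite mem_iota => lti; apply/allP => j; rewrite mem_iota => ltj.
  by have /forallP /(_ (Ordinal ltj)) := H (Ordinal lti).
move=> i; apply/forallP => j; have /H /allP : val i \in iota 0 (size s).
  by rewrite mem_iota ltn_ord.
by apply; rewrite mem_iota ltn_ord.
Qed.

Lemma occurrencesE (p w : seq nat) : occurrences p w =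
  \sum_(k < (size w).+1 - size p)
     order_isomorphic [seq nth 0 w i | i <- iota k (size p)] p.
Proof.
rewrite /occurrences -sum1_count big_mkcond /=.
rewrite -[0 :: _]/(index_iota 0 (size w).+1).
rewrite (@big_cat_nat _ _ _ ((size w).+1 - size p)) ?leq_subr //=.
rewrite [X in _ + X]big_nat_cond [X in _ + X]big1 ?addn0; last first.
  move=> k /andP[/andP[k1 k2] _]; rewrite ifF //; apply/negbTE.
  by rewrite negb_and; apply/orP; left; lia.
rewrite big_mkord; apply: eq_bigr => k _.
have kp : k + size p <= size w by have := ltn_ord k; lia.
rewrite kp /Defs.factor -(map_nth_iota 0); last by lia.
by case: (order_isomorphic _ _).
Qed.

Definition descent (w : seq nat) (k : nat) : bool := nth 0 w k.+1 < nth 0 w k.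

Lemma occurrences_21 (w : seq nat) :
  occurrences [:: 2; 1] w = \sum_(k < (size w).-1) descent w k.
Proof.
rewrite occurrencesE /= subSS subn1; apply: eq_bigr => -[k ltk] _ /=; congr nat_of_bool.
rewrite order_isomorphicE /= /descent; lia.
Qed.

Lemma nth_uniq_succ (w : seq nat) k : uniq w -> k.+1 < size w ->
  nth 0 w k != nth 0 w k.+1.
Proof. by move=> uw kw; rewrite nth_uniq ?(ltnW kw) // neq_ltn ltnSn. Qed.

Lemma occurrences_12 (w : seq nat) : uniq w ->
  occurrences [:: 1; 2] w + occurrences [:: 2; 1] w = (size w).-1.
Proof.
move=> uw; rewrite occurrences_21 occurrencesE /= subSS subn1 -big_split /=.
rewrite -[RHS]card_ord -sum1_card; apply: eq_bigr => -[k ltk] _ /=.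
rewrite order_isomorphicE /= /descent.
have : nth 0 w k != nth 0 w k.+1.
  by apply: nth_uniq_succ => //; lia.
lia.
Qed.

(** These two properties leave 123, 132 and 213 as the only possible factors of
length 3. *)
Definition faro_like (w : seq nat) : Prop :=
  uniq w /\ forall k, k.+2 < size w -> nth 0 w k < nth 0 w k.+2.

Lemma occurrences_213 (w : seq nat) : faro_like w ->
  occurrences [:: 2; 1; 3] w = \sum_(k < (size w).-2) descent w k.
Proof.
move=> [uw fw]; rewrite occurrencesE /= subSS subn2; apply: eq_bigr => -[k ltk] _ /=.
congr nat_of_bool; rewrite order_isomorphicE /= /descent.
have := fw k; lia.
Qed.

Lemma occurrences_132 (w : seq nat) : faro_like w ->
  occurrences [:: 1; 3; 2] w = \sum_(k < (size w).-2) descent w k.+1.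
Proof.
move=> [uw fw]; rewrite occurrencesE /= subSS subn2; apply: eq_bigr => -[k ltk] _ /=.
congr nat_of_bool; rewrite order_isomorphicE /= /descent.
have := fw k; lia.
Qed.

Lemma occurrences_123 (w : seq nat) : faro_like w ->
  occurrences [:: 1; 2; 3] w + occurrences [:: 1; 3; 2] w
    + occurrences [:: 2; 1; 3] w = (size w).-2.
Proof.
move=> fw; rewrite occurrences_132 // occurrences_213 //; case: fw => uw fw.
rewrite occurrencesE /= subSS subn2 -!big_split /=.
rewrite -[RHS]card_ord -sum1_card; apply: eq_bigr => -[k ltk] _ /=.
rewrite order_isomorphicE /= /descent.
have : nth 0 w k != nth 0 w k.+1 by apply: nth_uniq_succ => //; lia.
have : nth 0 w k.+1 != nth 0 w k.+2 by apply: nth_uniq_succ => //; lia.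
have := fw k; lia.
Qed.

Lemma sorted_nth_ltn (s : seq nat) i j : sorted ltn s -> i < j < size s ->
  nth 0 s i < nth 0 s j.
Proof.
move=> ss /andP[ij js]; have is_ := ltn_trans ij js.
exact: (sorted_ltn_nth ltn_trans 0 ss i j is_ js ij).
Qed.

Lemma faro_word_nth n b k : b \in balanced_bits n ->
  nth 0 (faro_word b) k = if odd k then nth 0 (lower b) k./2 else nth 0 (upper b) k./2.
Proof. by move=> bn; rewrite nth_interlace // (upper_lower_size bn). Qed.

Lemma size_faro_word b : size (faro_word b) = size b.
Proof. by rewrite (perm_size (faro_word_perm b)) size_iota. Qed.

Lemma faro_word_like n b : b \in balanced_bits n -> faro_like (faro_word b).
Proof.
move=> bn; split; first by rewrite (perm_uniq (faro_word_perm b)) iota_uniq.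
have [sb cb su sl] := balancedP bn.
move=> k; rewrite size_faro_word sb => kn; rewrite !(faro_word_nth _ bn) /= negbK.
by case: ifP => ok; apply: sorted_nth_ltn; rewrite ?upper_sorted ?lower_sorted //; lia.
Qed.

Lemma popularityE p n :
  popularity p n = \sum_(b <- balanced_bits n) occurrences p (faro_word b).
Proof. by rewrite /popularity (perm_big _ (faro_perms_words n)) big_map. Qed.

Lemma size_balanced n : size (balanced_bits n) = 'C(n, n./2).
Proof.
rewrite -sum1_size sum_balanced.
under eq_bigr do rewrite muln1.
rewrite sum_bits_count -bin_sub; last by lia.
by congr 'C(_, _); lia.
Qed.

Lemma popularity_12 n :
  popularity [:: 1; 2] n + popularity [:: 2; 1] n = n.-1 * 'C(n, n./2).
Proof.
rewrite !popularityE -big_split /= -size_balanced -sum1_size big_distrr /=.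
apply: eq_big_seq => b bn; rewrite muln1.
rewrite occurrences_12; last by have [] := faro_word_like bn.
by rewrite size_faro_word; have [-> _ _ _] := balancedP bn.
Qed.

Lemma popularity_123 n :
  popularity [:: 1; 2; 3] n + popularity [:: 1; 3; 2] n
    + popularity [:: 2; 1; 3] n = n.-2 * 'C(n, n./2).
Proof.
rewrite !popularityE -!big_split /= -size_balanced -sum1_size big_distrr /=.
apply: eq_big_seq => b bn; rewrite muln1.
rewrite occurrences_123; last exact: faro_word_like bn.
by rewrite size_faro_word; have [-> _ _ _] := balancedP bn.
Qed.

(** Every descent, unless in the last position, opens a 213. *)
Lemma popularity_213 n : 2 <= n ->
  popularity [:: 2; 1; 3] n + \sum_(b <- balanced_bits n) descent (faro_word b) n.-2
  = popularity [:: 2; 1] n.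
Proof.
move=> n2; rewrite !popularityE -!big_split /=; apply: eq_big_seq => b bn.
rewrite occurrences_21 (occurrences_213 (faro_word_like bn)) size_faro_word.
have [-> _ _ _] := balancedP bn.
by case: n n2 bn => [|[|n]] //= _ _; rewrite [RHS]big_ord_recr.
Qed.

(** Every descent, unless in the first position, closes a 132. *)
Lemma popularity_132 n : 2 <= n ->
  popularity [:: 1; 3; 2] n + \sum_(b <- balanced_bits n) descent (faro_word b) 0
  = popularity [:: 2; 1] n.
Proof.
move=> n2; rewrite !popularityE -!big_split /=; apply: eq_big_seq => b bn.
rewrite occurrences_21 (occurrences_132 (faro_word_like bn)) size_faro_word.
have [-> _ _ _] := balancedP bn.
by case: n n2 bn => [|[|n]] //= _ _; rewrite [RHS]big_ord_recl addnC.
Qed.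

(** * Descents and returns to height 0 *)

(** In an increasing word, the letters below [y] form a prefix. *)
Lemma sorted_count_ltn (s : seq nat) i y : sorted ltn s ->
  (i < count (fun x => x < y) s) = (i < size s) && (nth 0 s i < y).
Proof.
elim: s i => [|x s IH] i //= ps; have ss := path_sorted ps.
have [xy|yx] := ltnP x y; first by case: i => [|i] //=; rewrite add1n !ltnS IH.
have all_ge : all (fun z => y <= z) (x :: s).
  rewrite /= yx; apply: sub_all (order_path_min ltn_trans ps) => z.
  by move=> /ltnW; apply: leq_trans.
rewrite add0n (_ : count _ s = 0); last first.
  case/andP: all_ge => _ /allP ge; apply/eqP; rewrite -leqn0 leqNgt -has_count.
  by apply/hasPn => z /ge; rewrite -leqNgt.
apply/esym/negbTE; rewrite negb_and -implybE -leqNgt; apply/implyP => si.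
by apply: (allP all_ge); rewrite mem_nth.
Qed.

Lemma count_ltn_nth (s : seq nat) i : sorted ltn s -> i < size s ->
  count (fun x => x < nth 0 s i) s = i.
Proof.
move=> ss si; apply/eqP; rewrite eqn_leq; apply/andP; split.
  by rewrite leqNgt sorted_count_ltn // ltnn andbF.
case: i si => // i si; rewrite sorted_count_ltn //.
by rewrite sorted_nth_ltn ?(ltnW si) // ltnSn.
Qed.

Lemma big_mask_iota (c : bitseq) m (G : nat -> nat) :
  \sum_(y <- mask c (iota m (size c))) G y =
  \sum_(k < size c) nth false c k * G (m + k).
Proof.
elim: c m => [|x c IH] m /=; first by rewrite big_nil big_ord0.
rewrite big_ord_recl /= addn0.
under [in RHS]eq_bigr do rewrite /bump /= add1n -addSnnS.
by rewrite -IH; case: x; rewrite ?big_cons ?mul1n // mul0n.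
Qed.

Lemma count_mask_iota (c : bitseq) m k :
  count (fun x => x < m + k) (mask c (iota m (size c))) = count id (take k c).
Proof.
elim: c m k => [|x c IH] m [|k] //.
  rewrite take0 addn0; apply/eqP; rewrite -leqn0 leqNgt -has_count.
  by apply/hasPn => z /mem_mask; rewrite mem_iota -leqNgt => /andP[].
by rewrite -addSnnS; case: x => /=; rewrite IH // leq_addr.
Qed.

Lemma big_ord_double h (f : nat -> nat) :
  \sum_(k < h.*2) f k = \sum_(i < h) (f i.*2 + f i.*2.+1).
Proof.
elim: h => [|h IH]; first by rewrite !big_ord0.
by rewrite doubleS !big_ord_recr /= IH addnA.
Qed.

(** The step number [k], counted from 0, goes from height 1 down to height 0:
among the [k] steps before it, the up steps exceed the down steps by one. *)
Definition return_at (b : bitseq) (k : nat) : bool :=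
  ~~ nth true b k && (count id (take k b) == (k - count id (take k b)).+1).

(** The [i]-th letter of [lower b] marks the [i]-th down step, and the letters
of [upper b] below it are the up steps made before. *)
Lemma sum_return_at n b : b \in balanced_bits n ->
  \sum_(k < n) return_at b k =
  \sum_(i < n./2) (count (fun x => x < nth 0 (lower b) i) (upper b) == i.+1).
Proof.
move=> bn; have [sb _ _ sl] := balancedP bn.
(* The rank of the letter number [i] of [lower b] is [i] itself. *)
transitivity (\sum_(y <- lower b) (count (fun x => x < y) (upper b)
    == (count (fun x => x < y) (lower b)).+1)); last first.
  rewrite (big_nth 0) sl big_mkord; apply: eq_bigr => i _.
  by rewrite (count_ltn_nth (lower_sorted b)) // sl.
rewrite /lower -(size_map negb) big_mask_iota size_map sb.
apply: eq_bigr => -[k kn] _ /=.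
rewrite (nth_map true) ?sb // /upper count_mask_iota -[in iota 1 n]sb -(size_map negb b).
rewrite count_mask_iota -map_take count_negb size_takel ?sb ?(ltnW kn) //.
by rewrite mulnb.
Qed.

(** Positions are grouped in pairs around each letter of [lower b]: such a
letter [v_i] makes one descent with [u_i] or [u_(i+1)], unless it lies between
them, which happens exactly at a return. *)
Lemma descents_returns n b : b \in balanced_bits n ->
  \sum_(k < n.-1) descent (faro_word b) k + \sum_(k < n) return_at b k = n./2.
Proof.
move=> bn; have [sb _ su sl] := balancedP bn.
(* Padding to an even number of positions, for even [n], so that they pair up. *)
have -> : \sum_(k < n.-1) descent (faro_word b) k =
    \sum_(k < (n./2).*2) ((k < n.-1) && descent (faro_word b) k).
  rewrite (big_ord_widen_cond (n./2).*2 xpredT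
    (fun k => nat_of_bool (descent (faro_word b) k))); last by lia.
  by rewrite big_mkcond; apply: eq_bigr => k _ /=; case: ifP.
rewrite (big_ord_double _
  (fun k => nat_of_bool ((k < n.-1) && descent (faro_word b) k))).
rewrite sum_return_at // -big_split /= -[RHS]card_ord -sum1_card.
apply: eq_bigr => -[i ih] _ /=.
rewrite /descent !(faro_word_nth _ bn) /= !odd_double /= uphalf_double doubleK.
set u := upper b; set v := lower b.
have /= H j := sorted_count_ltn j (nth 0 v i) (upper_sorted b).
have := H i; have := H i.+1; rewrite -/u su.
set c := count _ _.
(* Letters of [upper b] and [lower b] differ, as the word has no repetition. *)
have neq j : j < uphalf n -> nth 0 u j != nth 0 v i.
  move=> ju; apply/eqP => e.
  have := perm_uniq (perm_interlace u v).
  have [-> _] := faro_word_like bn.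
  rewrite cat_uniq => /esym/and3P[_ /hasPn/(_ (nth 0 v i)) + _].
  by rewrite mem_nth ?sl // -e mem_nth ?su // => /(_ isT).
have := neq i; have := neq i.+1.
lia.
Qed.

(** * The total number of returns *)

(** The prefix of length [k], the down step number [k] and the remaining steps
are chosen independently. *)
Lemma sum_bits_prefix n k a c : k < n -> c <= a ->
  \sum_(b <- bits n) (count id b == a) *
      (~~ nth true b k && (count id (take k b) == c)) =
  'C(k, c) * 'C(n - k.+1, a - c).
Proof.
move=> kn ca; have {1}-> : n = k + (1 + (n - k.+1)) by lia.
rewrite big_bits_cat -sum_bits_count big_distrl /=; apply: eq_big_seq => x.
rewrite mem_bits => /eqP sx; rewrite big_cat !big_map -sum_bits_count big_distrr /=.
rewrite big1 => [|y _]; last by rewrite nth_cat sx ltnn subnn /= muln0.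
rewrite add0n; apply: eq_bigr => y _.
rewrite nth_cat sx ltnn subnn take_size_cat //= count_cat /= add0n.
have [->|] := eqVneq (count id x) c; last by rewrite muln0.
by rewrite muln1 mul1n; congr nat_of_bool; apply/eqP/eqP; lia.
Qed.

Lemma bin_double_succ k : 'C(k.+1.*2, k.+1) = 2 * 'C(k.*2.+1, k).
Proof.
rewrite doubleS binS mulSn mul1n; congr (_ + _).
by rewrite -bin_sub; [congr 'C(_, _)|]; lia.
Qed.

Lemma central_rec k : k.+1 * 'C(k.+1.*2, k.+1) = (4 * k + 2) * 'C(k.*2, k).
Proof.
rewrite bin_double_succ mulnCA.
have -> : k.+1 * 'C(k.*2.+1, k) = k.*2.+1 * 'C(k.*2, k).
  by rewrite (mul_bin_down k.*2.+1 k); congr (_ * _); lia.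
by rewrite mulnA; congr (_ * _); lia.
Qed.

(** With [a k = C(2k, k)], let [S m] be the sum of [a k * a (m - k)] and [T m]
the same sum weighted by [k].  The symmetry [k <-> m - k] gives
[2 * T m = m * S m], and the recurrence of [a] gives
[T (m+1) = 4 * T m + 2 * S m]; together, [S (m+1) = 4 * S m]. *)
Lemma central_convolution m :
  \sum_(k < m.+1) 'C(k.*2, k) * 'C((m - k).*2, m - k) = 4 ^ m.
Proof.
pose a k := 'C(k.*2, k).
pose S m := \sum_(k < m.+1) a k * a (m - k).
pose T m := \sum_(k < m.+1) k * (a k * a (m - k)).
have TS n : T n * 2 = n * S n.
  rewrite muln2 -addnn {2}/T (reindex_inj rev_ord_inj) /= -big_split big_distrr.
  apply: eq_bigr => -[k kn] _ /=; rewrite subSS subKn -1?ltnS //.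
  by rewrite [a (n - k) * _]mulnC -mulnDl subnKC.
have TE n : T n.+1 = 4 * T n + 2 * S n.
  rewrite /T big_ord_recl mul0n add0n !big_distrr -big_split /=.
  apply: eq_bigr => k _; rewrite /bump /= add1n subSS mulnA /a central_rec; lia.
have SE n : S n.+1 = 4 * S n.
  apply/eqP; rewrite -(eqn_pmul2l (isT : 0 < n.+1)) -TS TE mulnDl -mulnA TS; lia.
rewrite -/(S m); elim: m => [|m IH]; first by rewrite /S big_ord1.
by rewrite SE IH expnS.
Qed.

(** The number of pairs formed by a path and a return of it: counting steps
from 0, a return has an odd number [2j + 1] and comes after [j + 1] up steps. *)
Definition total_returns n :=
  \sum_(j < n./2) 'C(j.*2.+1, j.+1) * 'C(n - j.+1.*2, uphalf n - j.+1).

Lemma bin_odd_half j : 2 * 'C(j.*2.+1, j.+1) = 'C(j.+1.*2, j.+1).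
Proof.
rewrite bin_double_succ -bin_sub; last by lia.
by congr (2 * 'C(_, _)); lia.
Qed.

(** Each [C(2j+1, j+1)] is half of [C(2j+2, j+1)].  For odd [n] the same holds of
the second factors, and the sum becomes the convolution without its two
extreme terms; for even [n] the second factors are already central, and only
the first term of the convolution is missing. *)
Lemma total_returnsE n : 2 * total_returns n + 'C(n, n./2) * (odd n).+1 = 2 ^ n.
Proof.
have p2 m : 2 ^ m.*2 = 4 ^ m by rewrite -mul2n expnM.
have := odd_double_half n; set m := n./2; case: (odd n) => /= <-.
  rewrite add1n expnS p2.
  have := central_convolution m.+1; rewrite big_ord_recl big_ord_recr /=.
  rewrite bin0 mul1n subn0 subnn bin0 muln1 bin_double_succ expnS.
  under eq_bigr => j _.
    rewrite -bin_odd_half /bump /= add1n subSS.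
    have -> : (m - j).*2 = (m - j).-1.+1.*2 by have := ltn_ord j; lia.
    have -> : m - j = (m - j).-1.+1 by have := ltn_ord j; lia.
    rewrite -bin_odd_half mulnACA; over.
  rewrite -big_distrr /= /total_returns.
  set A := \sum_(i < m) _; set B := \sum_(_ < _) _.
  have -> : B = A.
    rewrite /A /B -uphalfE uphalf_double; apply: eq_bigr => j _.
    congr (_ * 'C(_, _)); have := ltn_ord j; lia.
  lia.
rewrite add0n muln1 /total_returns doubleK uphalf_double big_distrr /=.
have := central_convolution m; rewrite big_ord_recl /= bin0 mul1n subn0 addnC.
rewrite p2 => <-; congr (_ + _); apply: eq_bigr => j _.
rewrite mulnA bin_odd_half /bump /= add1n; congr (_ * 'C(_, _)); lia.
Qed.

Lemma sum_total_returns n :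
  \sum_(b <- balanced_bits n) \sum_(k < n) return_at b k = total_returns n.
Proof.
rewrite exchange_big /=.
pose f k := \sum_(b <- balanced_bits n) (return_at b k : nat).
have f0 k : ~~ odd k -> k < n -> f k = 0.
  move=> ek kn; rewrite /f big_seq big1 // => b bn; rewrite /return_at.
  have := count_size id (take k b); have [sb _ _ _] := balancedP bn.
  rewrite size_takel ?sb ?(ltnW kn) //; move: (count _ _) => c ck.
  by rewrite (_ : c == _ = false) ?andbF //; lia.
have f1 j : j < n./2 ->
    f j.*2.+1 = 'C(j.*2.+1, j.+1) * 'C(n - j.+1.*2, uphalf n - j.+1).
  move=> jn; rewrite /f sum_balanced -[j.+1.*2]/(j.*2.+2) -sum_bits_prefix; last 2 first.
  - by lia.
  - by lia.
  apply: eq_big_seq => b; rewrite mem_bits => /eqP sb; congr (_ * nat_of_bool (_ && _)).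
  have := count_size id (take j.*2.+1 b); rewrite size_takel ?sb; last by lia.
  by move: (count _ _) => c; lia.
have -> : \sum_(k < n) f k = \sum_(k < (n./2).*2) f k.
  rewrite -[in LHS](odd_double_half n); case E : (odd n); last by rewrite add0n.
  rewrite add1n big_ord_recr /= (f0 _.*2) ?addn0 // ?odd_double //.
  by have := odd_double_half n; rewrite E; lia.
rewrite big_ord_double; apply: eq_bigr => -[j jn] _ /=.
rewrite f1 // f0 ?odd_double //; lia.
Qed.

Lemma popularity_21 n :
  2 * popularity [:: 2; 1] n + 2 ^ n = n.+1 * 'C(n, n./2).
Proof.
have H : popularity [:: 2; 1] n + total_returns n = n./2 * 'C(n, n./2).
  rewrite popularityE -sum_total_returns -big_split /= -size_balanced.
  rewrite -sum1_size big_distrr; apply: eq_big_seq => b bn /=.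
  rewrite occurrences_21 size_faro_word muln1 -(descents_returns bn).
  by have [-> _ _ _] := balancedP bn.
rewrite -(total_returnsE n) addnA -mulnDr H mulnA -[_ * _.+1]mulnC -mulnDl.
by congr (_ * _); lia.
Qed.

(** * Descents at both ends *)

(** The value 1 is at one of the first two positions: the first one when the
path starts with an up step, and the second one otherwise. *)
Lemma descent_first n b : 2 <= n -> b \in balanced_bits n ->
  descent (faro_word b) 0 = ~~ nth true b 0.
Proof.
move=> n2 bn; have [sb _ su sl] := balancedP bn; have [uw _] := faro_word_like bn.
have ne := nth_uniq_succ uw; have := ne 0; rewrite size_faro_word sb => /(_ n2) {}ne.
have ge k : k < n -> 1 <= nth 0 (faro_word b) k.
  move=> kn; have : nth 0 (faro_word b) k \in iota 1 (size b).
    by rewrite -(perm_mem (faro_word_perm b)) mem_nth // size_faro_word sb.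
  by rewrite mem_iota => /andP[].
have := ge 0; have := ge 1; move: ne.
rewrite /descent !(faro_word_nth _ bn) /=.
case: b bn sb su sl {uw ge} => [|x b] bn sb su sl; first by move: n2; rewrite -sb.
case: x bn sb su sl => bn sb su sl; rewrite /upper /lower /=; lia.
Qed.

Lemma sum_descent_first n : 2 <= n ->
  \sum_(b <- balanced_bits n) descent (faro_word b) 0 = 'C(n.-1, uphalf n).
Proof.
move=> n2; transitivity ('C(0, 0) * 'C(n - 1, uphalf n - 0)); last first.
  by rewrite mul1n subn0 subn1.
rewrite -sum_bits_prefix -?sum_balanced //; last by lia.
apply: eq_big_seq => b bn; rewrite (descent_first n2 bn).
by rewrite take0 andbT.
Qed.

Lemma sum_bits_rcons n (F : bitseq -> nat) :
  \sum_(b <- bits n.+1) F b =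
  \sum_(b <- bits n) (F (rcons b true) + F (rcons b false)).
Proof.
rewrite -addn1 big_bits_cat; apply: eq_bigr => b _.
by rewrite /= big_cons big_seq1 !cats1.
Qed.

Lemma iota1S n : iota 1 n.+1 = iota 1 n ++ [:: n.+1].
Proof. by rewrite -{1}[n.+1]addn1 iotaD add1n. Qed.

Lemma upper_rcons b x : upper (rcons b x) = upper b ++ nseq x (size b).+1.
Proof.
rewrite /upper size_rcons iota1S -cats1.
by rewrite mask_cat ?size_iota //; case: x.
Qed.

Lemma lower_rcons b x : lower (rcons b x) = lower b ++ nseq (~~ x) (size b).+1.
Proof.
rewrite /lower size_rcons map_rcons iota1S -cats1.
by rewrite mask_cat ?size_iota ?size_map //; case: x.
Qed.

(** The largest value is at one of the last two positions, and the last step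
of the path says whether it ends [upper] or [lower]; the parity of [n]
says which of the two positions ends [upper]. *)
Lemma descent_last n b x : 1 <= n -> rcons b x \in balanced_bits n.+1 ->
  descent (faro_word (rcons b x)) n.-1 = (x == odd n).
Proof.
move=> n1 bn; have [sb _ su sl] := balancedP bn; have [uw _] := faro_word_like bn.
have := @nth_uniq_succ _ n.-1 uw; rewrite size_faro_word sb.
have le k : nth 0 (faro_word (rcons b x)) k <= n.+1.
  have [kn|kn] := ltnP k n.+1; last by rewrite nth_default // size_faro_word sb.
  have : nth 0 (faro_word (rcons b x)) k \in iota 1 (size (rcons b x)).
    by rewrite -(perm_mem (faro_word_perm _)) mem_nth // size_faro_word sb.
  by rewrite mem_iota sb => /andP[].
have := le n.-1; have := le n.-1.+1.
rewrite /descent prednK // !(faro_word_nth _ bn) => {le uw}.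
have -> : odd n.-1 = ~~ odd n by lia.
move: sb; rewrite size_rcons => -[sb].
have nth_end (s : seq nat) y i : size (s ++ [:: y]) = i.+1 -> nth 0 (s ++ [:: y]) i = y.
  by rewrite size_cat addn1 => -[<-]; rewrite nth_cat ltnn subnn.
move: su sl; rewrite upper_rcons lower_rcons sb.
case: x {bn}; case: (boolP (odd n)) => on /= su sl.
- rewrite (nth_end (upper b) _ n.-1./2); [lia|rewrite su; lia].
- rewrite (nth_end (upper b) _ n./2); [lia|rewrite su; lia].
- rewrite (nth_end (lower b) _ n./2); [lia|rewrite sl; lia].
- rewrite (nth_end (lower b) _ n.-1./2); [lia|rewrite sl; lia].
Qed.

Lemma sum_descent_last n : 2 <= n ->
  \sum_(b <- balanced_bits n) descent (faro_word b) n.-2 = 'C(n.-1, uphalf n).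
Proof.
case: n => [|n] // n1; rewrite sum_balanced sum_bits_rcons /=.
(* The last step being fixed, what remains is to choose the up steps among
   the first [n]: one less when the last step is up. *)
transitivity ('C(n, uphalf n.+1 - odd n)); last first.
  case: (boolP (odd n)) => on; last by rewrite subn0.
  by rewrite -bin_sub; [congr 'C(_, _)|]; lia.
rewrite -sum_bits_count; apply: eq_big_seq => b; rewrite mem_bits => /eqP sb.
have H x : (count id (rcons b x) == uphalf n.+1) * descent (faro_word (rcons b x)) n.-1
    = (count id b + x == uphalf n.+1) && (x == odd n).
  rewrite -cats1 count_cat /= addn0; case: eqP => c; rewrite ?mul0n //.
  rewrite mul1n cats1 (descent_last n1) // mem_filter mem_bits size_rcons sb eqxx.
  by rewrite -cats1 count_cat /= addn0 c eqxx.
by rewrite !H; move: (count _ _) => c; case: (boolP (odd n)) => on; lia.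
Qed.

Lemma popularity_132_213 n : 2 <= n ->
  popularity [:: 1; 3; 2] n = popularity [:: 2; 1; 3] n.
Proof.
move=> n2; have := popularity_132 n2; rewrite -(popularity_213 n2).
by rewrite sum_descent_first // sum_descent_last // => /addIn.
Qed.

Lemma bin_half_pred n : 2 <= n ->
  'C(n.-1, uphalf n) + 'C(n.-1, n.-1./2) = 'C(n, n./2).
Proof.
case: n => // n _; rewrite /= -[in RHS]bin_sub; last by lia.
have -> : n.+1 - n.+1./2 = (n./2).+1 by lia.
by rewrite binS.
Qed.

(** Each of 132 and 213 has the popularity of 21 minus [C(n-1, uphalf n)], so
[popularity_123] leaves [C(n, n./2)] and [C(n-1, uphalf n)] as only binomials;
[bin_half_pred] puts the latter in the stated form. *)
Lemma popularity_123_closed n : 2 <= n ->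
  popularity [:: 1; 2; 3] n + 2 * 'C(n.-1, n.-1./2) + 'C(n, n./2) = 2 ^ n.
Proof.
move=> n2; have := popularity_123 n; have := popularity_132_213 n2.
have := popularity_213 n2; rewrite sum_descent_last //.
have := popularity_21 n; have := bin_half_pred n2.
have -> : n.+1 * 'C(n, n./2) = n.-2 * 'C(n, n./2) + 3 * 'C(n, n./2).
  by rewrite -mulnDl; congr (_ * _); lia.
lia.
Qed.

Local Open Scope classical_set_scope.
Local Open Scope ring_scope.

(** * Wallis numbers and central binomial coefficients *)

(** The primitive of [sin ^+ n] that vanishes at 0, by the reduction formula for
its integral. *)
Fixpoint sin_primitive (R : realType) (n : nat) (x : R) : R :=
  match n with
  | 0 => x
  | 1 => 1 - cos x
  | m.+2 =>
      m.+2%:R^-1 * (m.+1%:R * sin_primitive m x - cos x * sin x ^+ m.+1)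
  end.

Lemma is_derive_sin_primitive (R : realType) n (x : R) :
  is_derive x 1 (@sin_primitive R n) (sin x ^+ n).
Proof.
elim/ltn_ind: n x => -[|[|n]] IH x.
- by rewrite expr0; exact: is_derive_id.
- rewrite expr1 (_ : @sin_primitive R 1 = cst 1 - cos) //.
  by apply: is_derive_eq; rewrite sub0r opprK.
have dn : is_derive x 1 (@sin_primitive R n) (sin x ^+ n) by exact: IH.
have -> : @sin_primitive R n.+2 =
    n.+2%:R^-1 \*: (n.+1%:R \*: @sin_primitive R n - cos * (sin ^+ n.+1)).
  by apply/funext => y /=; rewrite !fctE.
apply: is_derive_eq; rewrite /GRing.scale /= exprfctE.
have n2 : n.+2%:R != 0 :> R by rewrite pnatr_eq0.
apply: (mulfI n2); rewrite mulVKf //.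
rewrite -[n.+2%:R]natr1 [cos x * _]mulrC -[_ * cos x * _]mulrA -expr2 cos2sin2.
by rewrite !exprS expr0; ring.
Qed.

(** The integral of [sin ^+ n] over [0, pi / 2]. *)
Definition wallis (R : realType) n : R := sin_primitive n (pi / 2 : R).

(** The boundary term [cos x * sin x ^+ n.+1] vanishes at [pi / 2]. *)
Lemma wallis_rec (R : realType) n :
  wallis R n.+2 = n.+1%:R / n.+2%:R * wallis R n.
Proof. by rewrite /wallis /= cos_pihalf mul0r subr0 mulrCA mulrA. Qed.

Definition central_prob (R : realType) (m : nat) : R := 'C(m.*2, m)%:R / 4 ^+ m.

Lemma central_gt0 (R : realType) m : 0 < central_prob R m.
Proof. by rewrite divr_gt0 ?exprn_gt0 // ltr0n bin_gt0; lia. Qed.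

Lemma central_succ (R : realType) m :
  central_prob R m.+1 = m.*2.+1%:R / m.*2.+2%:R * central_prob R m.
Proof.
have := congr1 (fun k : nat => k%:R : R) (central_rec m).
rewrite /central_prob -[m.*2.+2]/(m.+1.*2); set a := 'C(_, _); set b := 'C(_, _) => H.
have -> : a%:R = (2 * m%:R + 1) * 2 / (m%:R + 1) * b%:R :> R.
  have m1 : m%:R + 1 != 0 :> R by rewrite natr1 pnatr_eq0.
  apply: (mulfI m1); move: H; rewrite !natrM natrD natrM -addn1 natrD => ->.
  by field.
rewrite exprS -!mul2n natrM -!natr1 natrM; field.
apply/andP; split; last by rewrite natr1 pnatr_eq0.
by rewrite expf_neq0 // gt_eqF //; lra.
Qed.

Lemma wallis_central (R : realType) m :
  wallis R m.*2 = central_prob R m * (pi / 2) /\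
  wallis R m.*2.+1 = (m.*2.+1%:R * central_prob R m)^-1.
Proof.
elim: m => [|m [IHe IHo]].
  rewrite /wallis /central_prob /= cos_pihalf expr0 divr1 bin0 !mul1r subr0 invr1 //.
have c0 : central_prob R m != 0 by rewrite gt_eqF ?central_gt0.
rewrite doubleS !wallis_rec IHe IHo central_succ; split; first by rewrite !mulrA.
rewrite -!natr1.
have d0 : 0 <= m.*2%:R :> R by [].
field; rewrite c0 /=; do !(apply/andP; split) => //; lra.
Qed.

(** [sin ^+ n - sin ^+ n.+1] is nonnegative on [0, pi / 2], so its primitive is
nonnegative at [pi / 2], by the mean value theorem. *)
Lemma wallis_decreasing (R : realType) n : wallis R n.+1 <= wallis R n.
Proof.
pose f (x : R) := sin_primitive n x - sin_primitive n.+1 x.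
have df (x : R) : is_derive x 1 f (sin x ^+ n - sin x ^+ n.+1).
  have d1 := is_derive_sin_primitive n x; have d2 := is_derive_sin_primitive n.+1 x.
  exact: is_deriveB.
have pi0 : 0 <= pi / 2 :> R by rewrite divr_ge0 ?pi_ge0.
have [|c] := @MVT_segment R f _ 0 (pi / 2) pi0 (fun x _ => df x).
  apply: continuous_subspaceT => x; apply/differentiable_continuous/derivable1_diffP.
  exact: ex_derive.
have f0 : f 0 = 0.
  have H k : sin_primitive k (0 : R) = 0.
    elim/ltn_ind: k => -[|[|k]] IH //=; first by rewrite cos0 subrr.
    by rewrite IH // sin0 exprS mul0r !mulr0 subrr mulr0.
  by rewrite /f !H subrr.
rewrite in_itv /= => /andP[c0 cpi].
rewrite f0 subr0 -subr_ge0 /wallis -/(f _) => ->; rewrite mulr_ge0 ?subr0 //.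
have s0 : 0 <= sin c by rewrite sin_ge0_pi // c0; have := pi_ge0 R; lra.
by rewrite subr_ge0 exprS ler_piMl ?exprn_ge0 ?sin_le1.
Qed.

(** This is [wallis (2q+1) <= wallis (2q)]. *)
Lemma central_lower (R : realType) q :
  2 <= pi * q.*2.+1%:R * central_prob R q ^+ 2.
Proof.
have c0 := central_gt0 R q; have [we wo] := wallis_central R q.
have p0 : 0 < q.*2.+1%:R * central_prob R q by rewrite mulr_gt0.
have := wallis_decreasing R q.*2; rewrite we wo -div1r ler_pdivrMr //.
set c := central_prob R q; set k := q.*2.+1%:R => H.
have -> : pi * k * c ^+ 2 = c * (pi / 2) * (k * c) * 2 by field.
lra.
Qed.

(** This is [wallis (2q) <= wallis (2q-1)]. *)
Lemma central_upper (R : realType) q : pi * q.*2%:R * central_prob R q ^+ 2 <= 2.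
Proof.
case: q => [|q]; first by rewrite mulr0 mul0r.
have c0 := central_gt0 R q.+1; have [we _] := wallis_central R q.+1.
have [_ wo] := wallis_central R q.
have := wallis_decreasing R q.*2.+1; rewrite -doubleS we wo.
have -> : q.*2.+1%:R * central_prob R q = q.+1.*2%:R * central_prob R q.+1.
  rewrite central_succ -[q.*2.+2]/(q.+1.*2); move: (central_prob R q) => c.
  by rewrite mulrA mulrCA divff ?mulr1 // pnatr_eq0.
have p0 : 0 < q.+1.*2%:R * central_prob R q.+1 by apply: mulr_gt0; rewrite ?ltr0n.
rewrite -[X in _ <= X]div1r ler_pdivlMr //.
set c := central_prob R q.+1; set k := q.+1.*2%:R => H.
have -> : pi * k * c ^+ 2 = c * (pi / 2) * (k * c) * 2 by field.
lra.
Qed.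

(** The probability of exactly [n./2] heads in [n] fair coin tosses. *)
Definition half_mass (R : realType) (n : nat) : R := 'C(n, n./2)%:R / 2 ^+ n.

Lemma half_mass_central (R : realType) n : half_mass R n = central_prob R (uphalf n).
Proof.
have H : ('C(n, n./2) * 2 ^ odd n = 'C((uphalf n).*2, uphalf n))%N.
  case: (boolP (odd n)) => on; last by rewrite muln1; congr 'C(_, _); lia.
  have -> : uphalf n = (n./2).+1 by lia.
  by rewrite bin_double_succ mulnC; congr (2 * 'C(_, _))%N; lia.
have e : (uphalf n).*2 = (n + odd n)%N by lia.
rewrite /half_mass /central_prob -H natrM natrX.
have -> : (4 : R) ^+ uphalf n = 2 ^+ n * 2 ^+ odd n.
  by rewrite -exprD -e -mul2n exprM; congr (_ ^+ _); ring.
by field; rewrite !expf_neq0 // pnatr_eq0.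
Qed.

Lemma half_mass_bounds (R : realType) n :
  2 <= pi * (n%:R + 2) * half_mass R n ^+ 2 /\ pi * n%:R * half_mass R n ^+ 2 <= 2.
Proof.
have hp := pi_ge0 R; have hb := sqr_ge0 (half_mass R n); split.
  rewrite (le_trans (central_lower R (uphalf n))) // -half_mass_central.
  rewrite ler_wpM2r // ler_wpM2l // -(natrD _ n 2) ler_nat; lia.
rewrite (le_trans _ (central_upper R (uphalf n))) // -half_mass_central.
rewrite ler_wpM2r // ler_wpM2l // ler_nat; lia.
Qed.

(** The expected order of growth, up to the factor [2 ^+ n]. *)
Definition sqrt_scale (R : realType) (n : nat) : R := Num.sqrt (n%:R / (2 * pi)).

(** The leading term of the popularity of 21 is [n / 2 * C(n, n./2)]; this is its
quotient by the expected equivalent. *)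
Definition mass_ratio (R : realType) (n : nat) : R :=
  half_mass R n * (n%:R / 2) / sqrt_scale R n.

Lemma sqrt_scale_gt0 (R : realType) n : (0 < n)%N -> 0 < sqrt_scale R n.
Proof.
by move=> n0; rewrite sqrtr_gt0 divr_gt0 ?ltr0n // mulr_gt0 ?pi_gt0.
Qed.

Lemma sqrt_scale_sqr (R : realType) n : sqrt_scale R n ^+ 2 = n%:R / (2 * pi).
Proof. by rewrite sqr_sqrtr // divr_ge0 // mulr_ge0 ?pi_ge0. Qed.

(** The bounds on [half_mass] concern the square [r ^+ 2] of the ratio.  No square
root has to be estimated, since [r <= 1] implies [r ^+ 2 <= r]. *)
Lemma mass_ratio_bounds (R : realType) n : (0 < n)%N ->
  1 - 2 / n%:R <= mass_ratio R n <= 1.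
Proof.
move=> n0; have s0 := sqrt_scale_gt0 R n0; have [lo hi] := half_mass_bounds R n.
have p0 := pi_gt0 R; have nR : 0 < n%:R :> R by rewrite ltr0n.
have b0 : 0 <= half_mass R n by rewrite divr_ge0.
have r0 : 0 <= mass_ratio R n by rewrite divr_ge0 ?mulr_ge0 // ltW.
have r2 : mass_ratio R n ^+ 2 = pi * n%:R * half_mass R n ^+ 2 / 2.
  rewrite /mass_ratio exprMn exprVn sqrt_scale_sqr; move: (pi : R) p0 => p p0.
  by field; rewrite !gt_eqF.
have r1 : mass_ratio R n <= 1.
  by rewrite -(@expr_le1 _ 2) // r2; lra.
rewrite r1 andbT.
have : mass_ratio R n ^+ 2 <= mass_ratio R n by rewrite expr2 ler_piMr.
apply: le_trans.
have -> : 1 - 2 / n%:R = (n%:R - 2) / n%:R :> R by field; rewrite gt_eqF.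
rewrite ler_pdivrMr // r2; set b2 := half_mass R n ^+ 2 in lo hi *.
have b20 : 0 <= b2 by rewrite sqr_ge0.
nra.
Qed.

Lemma cvg_harmonic_c (R : realType) (c : R) : c * n.+1%:R^-1 @[n --> \oo] --> (0 : R).
Proof.
by rewrite -[X in _ --> X](mulr0 c); apply: cvgMr; exact: cvg_harmonic.
Qed.

Lemma cvg_mass_ratio (R : realType) : mass_ratio R n.+1 @[n --> \oo] --> (1 : R).
Proof.
apply: (@squeeze_cvgr _ _ _ _ (fun n => 1 - 2 * n.+1%:R^-1) (cst 1)).
- by near=> n; apply: mass_ratio_bounds.
- rewrite -[X in _ --> X]subr0; apply: cvgB; first exact: cvg_cst.
  exact: cvg_harmonic_c.
- exact: cvg_cst.
Unshelve. all: by end_near. Qed.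

Lemma cvg_inv_sqrt_scale (R : realType) : (sqrt_scale R n.+1)^-1 @[n --> \oo] --> (0 : R).
Proof.
have -> : (fun n => (sqrt_scale R n.+1)^-1) = (fun n => Num.sqrt (2 * pi * n.+1%:R^-1)).
  by apply/funext => n; rewrite /sqrt_scale -sqrtrV ?divr_ge0 ?mulr_ge0 ?pi_ge0 // invf_div.
have H : Num.sqrt (2 * pi * n.+1%:R^-1) @[n --> \oo] --> Num.sqrt (0 : R).
  apply: continuous_cvg; first exact: sqrt_continuous.
  exact: cvg_harmonic_c.
by rewrite sqrtr0 in H.
Qed.

Lemma cvg_half_mass (R : realType) : half_mass R n @[n --> \oo] --> (0 : R).
Proof.
rewrite -cvg_shiftS /=.
have -> : (fun n => half_mass R n.+1) =
    (fun n => mass_ratio R n.+1 * (sqrt_scale R n.+1)^-1 / pi).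
  apply/funext => n; rewrite /mass_ratio.
  have s0 : sqrt_scale R n.+1 != 0 by rewrite gt_eqF ?sqrt_scale_gt0.
  have p0 : pi != 0 :> R by rewrite gt_eqF ?pi_gt0.
  have n0 : n.+1%:R != 0 :> R by rewrite pnatr_eq0.
  have -> : half_mass R n.+1 * (n.+1%:R / 2) / sqrt_scale R n.+1 / sqrt_scale R n.+1 / pi =
      half_mass R n.+1 * (n.+1%:R / 2) / sqrt_scale R n.+1 ^+ 2 / pi.
    by move: (pi : R) p0 => p p0; field; rewrite s0 p0.
  rewrite sqrt_scale_sqr; move: (pi : R) (n.+1%:R : R) p0 n0 => p k p0 k0.
  by field; rewrite k0 p0.
have H : mass_ratio R n.+1 * (sqrt_scale R n.+1)^-1 / pi @[n --> \oo] --> (1 * 0 / pi : R).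
  apply: cvgM; last exact: cvg_cst.
  by apply: cvgM; [exact: cvg_mass_ratio|exact: cvg_inv_sqrt_scale].
by rewrite mulr0 mul0r in H.
Qed.

(** An equivalence only depends on large indices, so the quotient is asked for
at indices [n.+1] with [0 < n], where the closed forms hold. *)
Lemma equiv_of_ratio (R : realType) (f g q : nat -> R) :
  (forall n, (0 < n)%N -> f n.+1 = q n * g n.+1) -> q n @[n --> \oo] --> (1 : R) ->
  f ~_\oo g.
Proof.
move=> fq q1; apply/eqaddoP => e e0.
have [N _ HN] : \forall n \near \oo, `|1 - q n| < e by move/cvgrPdist_lt: q1 => /(_ e e0).
exists N.+2 => // -[|n] //= Nn.
rewrite !fctE fq; last by lia.
rewrite -{2}[g n.+1]mul1r -mulrBl normrM ler_wpM2r // distrC ltW //.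
by apply: HN => /=; lia.
Qed.

(** * Closed forms over the reals *)

Lemma popularity_21R (R : realType) n : (0 < n)%N ->
  (popularity [:: 2; 1]%N n)%:R =
    (n%:R + 1) / 2 * 'C(n, n./2)%:R - 2 ^+ (n - 1) :> R.
Proof.
case: n => // n _; have := congr1 (fun k => k%:R : R) (popularity_21 n.+1).
by rewrite natrD !natrM natrX subSS subn0 exprS -[n.+2%:R]natr1; lra.
Qed.

Lemma popularity_12R (R : realType) n : (0 < n)%N ->
  (popularity [:: 1; 2]%N n)%:R =
    (n%:R - 1) * 'C(n, n./2)%:R - (popularity [:: 2; 1]%N n)%:R :> R.
Proof.
case: n => // n _; have := congr1 (fun k => k%:R : R) (popularity_12 n.+1).
by rewrite natrD natrM -[n.+1%:R]natr1 addrK => <-; rewrite addrK.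
Qed.

Lemma popularity_123R (R : realType) n : (2 <= n)%N ->
  (popularity [:: 1; 2; 3]%N n)%:R =
    2 ^+ n - 2 * 'C(n - 1, (n - 1)./2)%:R - 'C(n, n./2)%:R :> R.
Proof.
move=> n2; have := congr1 (fun k => k%:R : R) (popularity_123_closed n2).
by rewrite natrD natrD natrM natrX subn1; lra.
Qed.

Lemma popularity_213R (R : realType) n : (2 <= n)%N ->
  (popularity [:: 2; 1; 3]%N n)%:R =
    2^-1 * ((n%:R - 2) * 'C(n, n./2)%:R
            - (popularity [:: 1; 2; 3]%N n)%:R) :> R.
Proof.
move=> n2; have := congr1 (fun k => k%:R : R) (popularity_123 n).
rewrite popularity_132_213 // natrM !natrD.
have -> : n.-2%:R = n%:R - 2 :> R by rewrite -(@natrB R n 2) // subn2.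
lra.
Qed.

(** * Asymptotic equivalents *)

Lemma binE (R : realType) n : 'C(n, n./2)%:R = half_mass R n * 2 ^+ n.
Proof. by rewrite /half_mass divfK // expf_neq0 // pnatr_eq0. Qed.

Lemma bin_ratioE (R : realType) n :
  'C(n.+1, n.+1./2)%:R =
    2 * mass_ratio R n.+1 * sqrt_scale R n.+1 / n.+1%:R * 2 ^+ n.+1.
Proof.
have s0 : sqrt_scale R n.+1 != 0 by rewrite gt_eqF ?sqrt_scale_gt0.
have k0 : n.+1%:R != 0 :> R by rewrite pnatr_eq0.
rewrite binE /mass_ratio; congr (_ * _).
move: (n.+1%:R : R) (sqrt_scale R _) k0 s0 => k s k0 s0.
by field; rewrite s0 k0.
Qed.

(** The [ratio_p] are the quotients, at [n.+1], of the popularities by their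
expected equivalents (for [0 < n] when [p] has length 3), with the binomial
coefficient expressed through [mass_ratio], whose limit is 1. *)
Definition ratio_21 (R : realType) (n : nat) : R :=
  (1 + 1 * n.+1%:R^-1) * mass_ratio R n.+1 - 2^-1 * (sqrt_scale R n.+1)^-1.

Definition ratio_12 (R : realType) (n : nat) : R :=
  2 * (1 - 1 * n.+1%:R^-1) * mass_ratio R n.+1 - ratio_21 R n.

Definition ratio_123 (R : realType) (n : nat) : R :=
  1 - half_mass R n - half_mass R n.+1.

Definition ratio_213 (R : realType) (n : nat) : R :=
  2^-1 * (2 * (1 - 2 * n.+1%:R^-1) * mass_ratio R n.+1
          - ratio_123 R n * (sqrt_scale R n.+1)^-1).

Lemma popularity_21_ratio (R : realType) n :
  (popularity [:: 2; 1]%N n.+1)%:R =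
    ratio_21 R n * (sqrt_scale R n.+1 * 2 ^+ n.+1).
Proof.
have s0 : sqrt_scale R n.+1 != 0 by rewrite gt_eqF ?sqrt_scale_gt0.
have k0 : n.+1%:R != 0 :> R by rewrite pnatr_eq0.
rewrite popularity_21R // bin_ratioE subn1 /ratio_21 [2 ^+ n.+1]exprS /=.
move: (n.+1%:R : R) (sqrt_scale R _) k0 s0 => k s k0 s0.
by field; rewrite k0 s0.
Qed.

Lemma popularity_12_ratio (R : realType) n :
  (popularity [:: 1; 2]%N n.+1)%:R =
    ratio_12 R n * (sqrt_scale R n.+1 * 2 ^+ n.+1).
Proof.
have k0 : n.+1%:R != 0 :> R by rewrite pnatr_eq0.
rewrite popularity_12R // popularity_21_ratio bin_ratioE /ratio_12.
move: (n.+1%:R : R) (ratio_21 R n) k0 => k q k0.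
by field.
Qed.

Lemma popularity_123_ratio (R : realType) n : (0 < n)%N ->
  (popularity [:: 1; 2; 3]%N n.+1)%:R = ratio_123 R n * 2 ^+ n.+1.
Proof.
move=> n0; rewrite popularity_123R // subn1 !binE /ratio_123 [2 ^+ n.+1]exprS.
by ring.
Qed.

Lemma popularity_213_ratio (R : realType) n : (0 < n)%N ->
  (popularity [:: 2; 1; 3]%N n.+1)%:R =
    ratio_213 R n * (sqrt_scale R n.+1 * 2 ^+ n.+1).
Proof.
move=> n0; rewrite popularity_213R // popularity_123_ratio // bin_ratioE.
have s0 : sqrt_scale R n.+1 != 0 by rewrite gt_eqF ?sqrt_scale_gt0.
have k0 : n.+1%:R != 0 :> R by rewrite pnatr_eq0.
rewrite /ratio_213.
move: (n.+1%:R : R) (sqrt_scale R _) (ratio_123 R n) k0 s0 => k s q k0 s0.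
by field; rewrite k0 s0.
Qed.

Lemma cvg_ratio_21 (R : realType) : ratio_21 R n @[n --> \oo] --> (1 : R).
Proof.
have H : ratio_21 R n @[n --> \oo] --> ((1 + 0) * 1 - 2^-1 * 0 : R).
  apply: cvgB; last by apply: cvgMr; exact: cvg_inv_sqrt_scale.
  apply: cvgM; last exact: cvg_mass_ratio.
  by apply: cvgD; [exact: cvg_cst|exact: cvg_harmonic_c].
by rewrite mulr0 subr0 addr0 mulr1 in H.
Qed.

Lemma cvg_ratio_12 (R : realType) : ratio_12 R n @[n --> \oo] --> (1 : R).
Proof.
have H : ratio_12 R n @[n --> \oo] --> (2 * (1 - 0) * 1 - 1 : R).
  apply: cvgB; last exact: cvg_ratio_21.
  apply: cvgM; last exact: cvg_mass_ratio.
  by apply: cvgMr; apply: cvgB; [exact: cvg_cst|exact: cvg_harmonic_c].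
by rewrite (_ : 2 * (1 - 0) * 1 - 1 = 1 :> R) in H; last by ring.
Qed.

Lemma cvg_ratio_123 (R : realType) : ratio_123 R n @[n --> \oo] --> (1 : R).
Proof.
have H : ratio_123 R n @[n --> \oo] --> (1 - 0 - 0 : R).
  apply: cvgB; last by rewrite (cvg_shiftS (half_mass R)); exact: cvg_half_mass.
  by apply: cvgB; [exact: cvg_cst|exact: cvg_half_mass].
by rewrite !subr0 in H.
Qed.

Lemma cvg_ratio_213 (R : realType) : ratio_213 R n @[n --> \oo] --> (1 : R).
Proof.
have H : ratio_213 R n @[n --> \oo] -->
    (2^-1 * (2 * (1 - 0) * 1 - 1 * 0) : R).
  apply: cvgMr; apply: cvgB; last first.
    by apply: cvgM; [exact: cvg_ratio_123|exact: cvg_inv_sqrt_scale].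
  apply: cvgM; last exact: cvg_mass_ratio.
  by apply: cvgMr; apply: cvgB; [exact: cvg_cst|exact: cvg_harmonic_c].
by rewrite (_ : 2^-1 * (2 * (1 - 0) * 1 - 1 * 0) = 1 :> R) in H; last by field.
Qed.

Theorem corollary3p7 (R : realType) :
  (forall n : nat, (2 <= n)%N ->
    [/\ (popularity [:: 2; 1]%N n)%:R =
          (n%:R + 1) / 2 * 'C(n, n./2)%:R - 2 ^+ (n - 1) :> R,
        (popularity [:: 1; 2]%N n)%:R =
          (n%:R - 1) * 'C(n, n./2)%:R - (popularity [:: 2; 1]%N n)%:R :> R,
        (popularity [:: 1; 2; 3]%N n)%:R =
          2 ^+ n - 2 * 'C(n - 1, (n - 1)./2)%:R - 'C(n, n./2)%:R :> R,
        (popularity [:: 1; 3; 2]%N n)%:R =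
          (popularity [:: 2; 1; 3]%N n)%:R :> R
      & (popularity [:: 2; 1; 3]%N n)%:R =
          2^-1 * ((n%:R - 2) * 'C(n, n./2)%:R
                  - (popularity [:: 1; 2; 3]%N n)%:R) :> R])
  /\
  (let g : nat -> R := fun n => Num.sqrt (n%:R / (2 * pi)) * 2 ^+ n in
   [/\ (fun n : nat => (popularity [:: 2; 1]%N n)%:R : R) ~_\oo g,
       (fun n : nat => (popularity [:: 1; 2]%N n)%:R : R) ~_\oo g,
       (fun n : nat => (popularity [:: 1; 3; 2]%N n)%:R : R) ~_\oo g,
       (fun n : nat => (popularity [:: 2; 1; 3]%N n)%:R : R) ~_\oo g
     & (fun n : nat => (popularity [:: 1; 2; 3]%N n)%:R : R)
         ~_\oo (fun n : nat => 2 ^+ n : R)]).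
Proof.
split=> [n n2|g].
  have n0 : (0 < n)%N by exact: ltnW.
  split; [exact: popularity_21R|exact: popularity_12R|exact: popularity_123R| |].
  - by rewrite popularity_132_213.
  - exact: popularity_213R.
split.
- by apply: equiv_of_ratio _ (@cvg_ratio_21 R) => n _; exact: popularity_21_ratio.
- by apply: equiv_of_ratio _ (@cvg_ratio_12 R) => n _; exact: popularity_12_ratio.
- apply: equiv_of_ratio _ (@cvg_ratio_213 R) => n n0.
  by rewrite popularity_132_213 //; exact: popularity_213_ratio.
- by apply: equiv_of_ratio _ (@cvg_ratio_213 R) => n n0; exact: popularity_213_ratio.
- by apply: equiv_of_ratio _ (@cvg_ratio_123 R) => n n0; exact: popularity_123_ratio.
Qed.
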